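(* If $G$ is a non-trivial graph of order $n \geq 2$, then $d(G) \leq n-1$.
   Context: Graphs are finite and simple; the order of a graph is its number of vertices. A graph is non-trivial if it has at least one edge. The deduction game on a graph $G$: a layout is a placement of searchers on vertices of $G$ (a vertex may receive several searchers). A vertex is occupied in the layout if it contains at least one searcher, and unoccupied otherwise. A vertex is protected if it is occupied in the initial layout or if a searcher has moved there at some point, and unprotected otherwise. A vertex is fireable if the number of searchers on it is greater than or equal to the number of its unprotected neighbours. Initially every searcher is mobile; once a searcher has moved once, it becomes immobile (cannot move again). At each stage, simultaneously, for every fireable vertex $v$ containing mobile searchers, one searcher moves from $v$ to each unprotected neighbour of $v$ (excess searchers stay on $v$; several fireable vertices may send a searcher to the same target). Stages continue until no new searchers move. The layout is successful if at the end all vertices of $G$ are protected. The deduction number $d(G)$ is the minimum number of searchers in a successful layout on $G$. *)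

(* Defs.v *)
From mathcomp Require Import all_boot.

Set Implicit Arguments.
Unset Strict Implicit.
Unset Printing Implicit Defensive.

(* A simple graph is a finType T of vertices with an adjacency relation e;
   its symmetry and irreflexivity are hypotheses of the theorem, as they play
   no role in the definition of the game. *)

Definition nontrivial (T : finType) (e : rel T) : Prop := exists x y, e x y.

Section DeductionGame.

Variables (T : finType) (e : rel T).

(* Number of searchers on each vertex: searchers are indistinguishable. *)
Definition layout := {ffun T -> nat}.

Record state := State {
  mobile : {ffun T -> nat};
  immobile : {ffun T -> nat};
  protected : {set T}
}.

Definition unprotected_nbrs (s : state) (v : T) : {set T} :=
  [set u | e v u & u \notin protected s].

Definition fireable (s : state) (v : T) : bool :=
  #|unprotected_nbrs s v| <= mobile s v + immobile s v.

Definition fires (s : state) (v : T) : bool :=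
  fireable s v && (0 < mobile s v).

(* A searcher moves along v -> u during the stage that starts in state s. *)
Definition moves (s : state) (v u : T) : bool :=
  fires s v && (u \in unprotected_nbrs s v).

(* The subtraction is never truncated in a reachable state: by
   [run_mobile_immobile] below, all searchers on a vertex that fires are
   mobile. *)
Definition stage (s : state) : state :=
  State [ffun v => mobile s v - #|[set u | moves s v u]|]
        [ffun v => immobile s v + #|[set u | moves s u v]|]
        (protected s :|: [set v | [exists u, moves s u v]]).

Definition start (f : layout) : state :=
  State f [ffun=> 0] [set v | 0 < f v].

Definition run (f : layout) (k : nat) : state := iter k stage (start f).

Definition stalled (s : state) : bool := [forall v, forall u, ~~ moves s v u].

(* #|T| stages are always enough for the game to stop, see [final_stalled]
   and [run_stalled]. *)
Definition final (f : layout) : state := run f #|T|.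

Definition successful (f : layout) : bool := protected (final f) == [set: T].

Definition searchers (f : layout) : nat := \sum_v f v.

(* Each vertex of a layout with m searchers holds at most m of them, so that
   the quantification can be over a finite type, see [winnableP]. *)
Definition winnable (m : nat) : bool :=
  [exists g : {ffun T -> 'I_m.+1},
     let f : layout := [ffun v => g v : nat] in
     (searchers f == m) && successful f].

Lemma run_mobile_immobile f k v :
  0 < mobile (run f k) v ->
  v \in protected (run f k) /\ immobile (run f k) v = 0.
Proof.
elim: k => [|k IH] /=; first by rewrite inE ffunE.
rewrite !ffunE => mv.
have /IH [pv iv] : 0 < mobile (run f k) v by apply: leq_trans mv (leq_subr _ _).
rewrite inE pv iv; split=> //; apply/eqP; rewrite add0n cards_eq0.
by apply/eqP/setP => u; rewrite !inE /moves inE pv !andbF.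
Qed.

Lemma moves_le_mobile f k v :
  #|[set u | moves (run f k) v u]| <= mobile (run f k) v.
Proof.
case fv: (fires (run f k) v); last first.
  by rewrite (eq_card0 (A := [set u | _])) // => u; rewrite inE /moves fv.
have /andP[] := fv; rewrite /fireable => lev /run_mobile_immobile[_ iv].
move: lev; rewrite iv addn0; apply: leq_trans; apply: subset_leq_card.
by apply/subsetP => u; rewrite inE => /andP[].
Qed.

Lemma stage_stalled s : stalled s -> stage s = s.
Proof.
case: s => m i p; set s := State m i p => /forallP st.
have nomove v u : moves s v u = false.
  by have /forallP/(_ u)/negbTE := st v.
congr State.
- apply/ffunP => v; rewrite ffunE (eq_card0 (A := [set u | _])) ?subn0 //.
  by move=> u; rewrite inE nomove.
- apply/ffunP => v; rewrite ffunE (eq_card0 (A := [set u | _])) ?addn0 //.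
  by move=> u; rewrite inE nomove.
- apply/setP => v; rewrite !inE; case: existsP => [[u]|]; last by rewrite orbF.
  by rewrite nomove.
Qed.

Lemma final_stalled f : stalled (final f).
Proof.
have H k : stalled (run f k) || (k <= #|protected (run f k)|).
  elim: k => [|k IH]; first by rewrite orbT.
  case st: (stalled (run f k)); first by rewrite /= stage_stalled // st.
  move: IH; rewrite st /= => IH; apply/orP; right.
  apply: leq_ltn_trans IH _; apply: proper_card; apply/properP; split.
    exact: subsetUl.
  move/negbT: st => /forallPn [v /forallPn [u]]; rewrite negbK => mvu.
  exists u; first by rewrite !inE; apply/orP; right; apply/existsP; exists v.
  by move: mvu; rewrite /moves inE => /and3P[].
case/orP: (H #|T|) => // full; apply/forallP => v; apply/forallP => u.
have /eqP pT : protected (final f) == [set: T].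
  by rewrite eqEcard subsetT cardsT.
by rewrite /moves !inE pT inE !andbF.
Qed.

Lemma run_stalled f k : stalled (run f k) -> run f k = final f.
Proof.
have fixs s n : stalled s -> iter n stage s = s.
  by move=> st; elim: n => //= n ->; apply: stage_stalled.
move=> st; rewrite -(fixs _ #|T| st) /run -iterD addnC iterD.
exact/fixs/final_stalled.
Qed.

Lemma winnableP m :
  reflect (exists2 f : layout, searchers f = m & successful f) (winnable m).
Proof.
apply: (iffP existsP) => [[g /andP[/eqP sg wg]]|[f sf wf]].
  by exists [ffun v => g v : nat].
have fm v : f v < m.+1 by rewrite ltnS -sf /searchers (bigD1 v) //= leq_addr.
exists [ffun v => Ordinal (fm v)] => /=.
have -> : [ffun v => [ffun v => Ordinal (fm v)] v : nat] = f :> layout.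
  by apply/ffunP => v; rewrite !ffunE.
by rewrite sf eqxx.
Qed.

Lemma winnable_ex : exists m, winnable m.
Proof.
exists #|T|; apply/winnableP; exists [ffun=> 1].
  by rewrite /searchers (eq_bigr (fun=> 1)) ?sum1_card // => v _; rewrite ffunE.
have H k : protected (run [ffun=> 1] k) = [set: T].
  elim: k => [|k IH] /=; first by apply/setP => v; rewrite !inE ffunE.
  by rewrite IH setTU.
by rewrite /successful H.
Qed.

Definition deduction_number : nat := ex_minn winnable_ex.

Lemma deduction_number_min (f : layout) :
  successful f -> deduction_number <= searchers f.
Proof.
move=> wf; rewrite /deduction_number; case: ex_minnP => m _; apply.
by apply/winnableP; exists f.
Qed.

End DeductionGame.

(* Main.v *)
Require Import Defs.
From mathcomp Require Import all_boot.

(** Since the graph has an edge [x y], it suffices to put one searcher on every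
    vertex except [y]. Then [y] is the only unprotected vertex, hence the only
    unprotected neighbour of [x], and the searcher on [x] protects it in the
    first stage ([all_but_successful]). *)

Definition all_but {T : finType} (y : T) : layout T := [ffun v => (v != y) : nat].

Lemma searchers_all_but {T : finType} (y : T) : searchers (all_but y) = #|T| - 1.
Proof.
rewrite /searchers (eq_bigr (fun v => (v != y) : nat)); last first.
  by move=> v _; rewrite ffunE.
by rewrite -big_mkcond sum1_card subn1 -(cardC1 y); apply: eq_card.
Qed.

(** A move needs an unprotected target, so once every vertex is protected the
    game has reached its final state; this spares counting the stages. *)
Lemma successful_of_run {T : finType} {e : rel T} {f : layout T} (k : nat) :
  protected (run e f k) = [set: T] -> successful e f.
Proof.
move=> pT; rewrite /successful -(@run_stalled T e f k) ?pT //.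
apply/forallP => v; apply/forallP => u.
by rewrite /moves !inE pT inE !andbF.
Qed.

(** The searcher on [x] is enough because [y] is the only vertex that can count
    among the unprotected neighbours of [x]. *)
Lemma all_but_successful {T : finType} {e : rel T} {x y : T} :
  e x y -> x != y -> successful e (all_but y).
Proof.
move=> exy xy; apply: (successful_of_run 1); apply/setP => v /=.
rewrite !inE ffunE; case: (eqVneq v y) => //= ->.
apply/existsP; exists x.
rewrite /moves /fires /fireable /= !inE !ffunE exy xy eqxx /= !andbT.
rewrite addn0 -(cards1 y); apply/subset_leq_card/subsetP => u.
by rewrite !inE ffunE; case: (u == y); rewrite ?andbF.
Qed.

Theorem theorem3p1 (T : finType) (e : rel T) (n : nat)
    (e_sym : symmetric e) (e_irr : irreflexive e)
    (order_n : #|T| = n) (n_ge2 : 2 <= n) (e_nontrivial : nontrivial e) :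
  deduction_number e <= n - 1.
Proof.
case: e_nontrivial => x [y exy].
have xy : x != y by apply: contraTneq exy => ->; rewrite e_irr.
rewrite -order_n -(searchers_all_but y).
exact/deduction_number_min/(all_but_successful exy xy).
Qed.
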